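(* Fix an LE-signature $(\mathcal{F},\mathcal{G})$. Let $\Pi\vdash\Sigma$ be a sequent which does not contain residuals and which is not derivable in the display calculus $\mathrm{D.LE}$. Then the antisequent $\Pi\nvdash\Sigma$ is derivable in the refutation calculus $\mathrm{D.LE}^r$.
   Context: Order-types. An order-type on $n$ is $\epsilon\in\{1,\partial\}^n$. The product on $\{1,\partial\}$ behaves like multiplication on $\{1,-1\}$. Notation: $\varphi\vdash^1\psi$ and $\varphi\nvdash^1\psi$ are $\varphi\vdash\psi$ and $\varphi\nvdash\psi$; $\varphi\vdash^\partial\psi$ means $\psi\vdash\varphi$ and $\varphi\nvdash^\partial\psi$ means $\psi\nvdash\varphi$. Also $\check\bot^1=\check\bot$, $\check\bot^\partial=\hat\top$, $\hat\top^1=\hat\top$, $\hat\top^\partial=\check\bot$. Language. $\mathcal{F},\mathcal{G}$ are disjoint sets of connectives with arities $n_f,n_g$ and order-types $\epsilon_f,\epsilon_g$. Formulas: $\varphi::=p\mid\bot\mid\top\mid\varphi\wedge\varphi\mid\varphi\vee\varphi\mid f(\varphi_1,..,\varphi_{n_f})\mid g(\varphi_1,..,\varphi_{n_g})$, with $p$ an atom, $f\in\mathcal{F}$, $g\in\mathcal{G}$. Residuated expansion. Add $f^\sharp_i$ for each $f\in\mathcal{F}$, $1\le i\le n_f$, and $g^\flat_i$ for each $g\in\mathcal{G}$, $1\le i\le n_g$. Put $f^\sharp_i$ in $\mathcal{G}^*$ if $\epsilon_f(i)=1$ and in $\mathcal{F}^*$ otherwise. Put $g^\flat_i$ in $\mathcal{F}^*$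 if $\epsilon_g(i)=1$ and in $\mathcal{G}^*$ otherwise. Also $\mathcal{F}\subseteq\mathcal{F}^*$ and $\mathcal{G}\subseteq\mathcal{G}^*$. Order-types: $\epsilon_{f^\sharp_i}(i)=\epsilon_f(i)$ and $\epsilon_{f^\sharp_i}(j)=\epsilon_f(j)\cdot\epsilon_f^\partial(i)$ for $j\neq i$, and likewise for $g^\flat_i$. Structures. Structural connectives are $\hat h$ ($h\in\mathcal{F}^*$) and $\check h$ ($h\in\mathcal{G}^*$), with the arity and order-type of $h$. Precedent structures are $\Pi::=\varphi\mid\hat\top\mid\hat f(\overline\Upsilon)$. Succedent structures are $\Sigma::=\varphi\mid\check\bot\mid\check g(\overline\Upsilon)$. The $i$-th argument of $\hat f$ (resp. $\check g$) is precedent if that coordinate has order-type $1$ (resp. $\partial$) and succedent otherwise. Sequents are $\Pi\vdash\Sigma$ and antisequents are $\Pi\nvdash\Sigma$. A sequent contains residuals if it contains some $\hat h$ or $\check h$ with $h$ one of the added $f^\sharp_i,g^\flat_i$. Display rules (invertible; $\bowtie$ is $\vdash$ or $\nvdash$), for $f\in\mathcal{F}$, $g\in\mathcal{G}$: - If $\epsilon_f(i)=1$: $\hat f(..,\Pi_i,..)\bowtie\Sigma$ iff $\Pi_i\bowtie\check f^\sharp_i(..,\Sigma,..)$. - If $\epsilon_f(i)=\partial$: $\hat f(..,\Sigma_i,..)\bowtie\Sigma$ iff $\hat f^\sharp_i(..,\Sigma,..)\bowtie\Sigma_i$. - If $\epsilon_g(j)=1$: $\Pi\bowtie\check g(..,\Sigma_j,..)$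 iff $\hat g^\flat_j(..,\Pi,..)\bowtie\Sigma_j$. - If $\epsilon_g(j)=\partial$: $\Pi\bowtie\check g(..,\Pi_j,..)$ iff $\Pi_j\bowtie\check g^\flat_j(..,\Pi,..)$. In each case the other arguments are unchanged. Display-equivalence, precedent/succedent position of a substructure occurrence (the occurrence can be made the whole left/right side by display rules), and substitutions $\Sigma'[A_i]^{pre}$ (replacing an occurrence of $A_i\wedge B_i$ in precedent position by $A_i$; similarly for $B_i$, and for $C_j$, $D_j$ replacing an occurrence of $C_j\vee D_j$ in succedent position) are defined accordingly. Branching. Signed generation trees are formed by giving the root of $\Pi$ sign $+$ and the root of $\Sigma$ sign $-$. Signs propagate through all structural and operational connectives: a child in a coordinate of order-type $1$ gets the same sign, of order-type $\partial$ the opposite sign; $\wedge,\vee$ have order-type $(1,1)$. A structure is branching if its signed tree contains a $+\vee$ or $-\wedge$ node such that all nodes strictly between it and the root are labelled in $\{+f,+\hat f,-g,-\check g\mid f\in\mathcal{F},g\in\mathcal{G}\}$. Calculus $\mathrm{D.LE}$ (on sequents): - Axioms and cut: $p\vdash p$; Cut: from $\Pi\vdash\varphi$ and $\varphi\vdash\Sigma$ infer $\Pi\vdash\Sigma$. - The display rules above. - Weakening: $\top_W$: from $\hat\top\vdash\Sigma$ infer $\Pi\vdash\Sigma$. $\bot_W$: from $\Pi\vdash\check\bot$ infer $\Pi\vdash\Sigma$. - Constants: $\top_L$: $\hat\top\vdash\Sigma$ / $\top\vdash\Sigma$. Axiom $\hat\top\vdash\top$. Axiom $\bot\vdash\check\bot$.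 $\bot_R$: $\Pi\vdash\check\bot$ / $\Pi\vdash\bot$. - Lattice rules: $\wedge_{L1}$: $\varphi\vdash\Sigma$ / $\varphi\wedge\psi\vdash\Sigma$. $\wedge_{L2}$: $\psi\vdash\Sigma$ / $\varphi\wedge\psi\vdash\Sigma$. $\wedge_R$: $\Pi\vdash\varphi$, $\Pi\vdash\psi$ / $\Pi\vdash\varphi\wedge\psi$. $\vee_L$: $\varphi\vdash\Sigma$, $\psi\vdash\Sigma$ / $\varphi\vee\psi\vdash\Sigma$. $\vee_{R1},\vee_{R2}$: $\Pi\vdash\varphi$ (resp. $\Pi\vdash\psi$) / $\Pi\vdash\varphi\vee\psi$. - For $f\in\mathcal{F}$, $g\in\mathcal{G}$: $f_L$: $\hat f(\overline\varphi)\vdash\Sigma$ / $f(\overline\varphi)\vdash\Sigma$. $g_R$: $\Pi\vdash\check g(\overline\varphi)$ / $\Pi\vdash g(\overline\varphi)$. $f_R$: from $\Upsilon_i\vdash^{\epsilon_f(i)}\varphi_i$ for all $i$ infer $\hat f(\overline\Upsilon)\vdash f(\overline\varphi)$. $g_L$: from $\varphi_i\vdash^{\epsilon_g(i)}\Upsilon_i$ for all $i$ infer $g(\overline\varphi)\vdash\check g(\overline\Upsilon)$. For $0$-ary connectives the last two are the axioms $\hat f\vdash f$ and $g\vdash\check g$. Calculus $\mathrm{D.LE}^r$ (on antisequents; $f,f_1,f_2\in\mathcal{F}$, $g,g_1,g_2\in\mathcal{G}$): - Axioms: $\hat\top\nvdash\check\bot$; $p\nvdash\check\bot$; $\hat\top\nvdash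 q$; $p\nvdash q$ ($p,q$ distinct atoms). - The display rules above with $\nvdash$. - Structural rules, whose conclusion must contain no residuals: - From $\Upsilon_i\nvdash^{\epsilon_f(i)}\check\bot^{\epsilon_f(i)}$ for all $i$, infer $\hat f(\overline\Upsilon)\nvdash\check\bot$, and also $\hat f(\overline\Upsilon)\nvdash p$. - From $\hat\top^{\epsilon_g(i)}\nvdash^{\epsilon_g(i)}\Upsilon_i$ for all $i$, infer $\hat\top\nvdash\check g(\overline\Upsilon)$, and also $p\nvdash\check g(\overline\Upsilon)$. - From both families (for $\overline\Upsilon$ and $\overline{\Upsilon'}$), infer $\hat f(\overline\Upsilon)\nvdash\check g(\overline{\Upsilon'})$. - Logical rules: - Zero-premise: $g(\overline\varphi)\nvdash\check\bot$, $g(\overline\varphi)\nvdash p$, $p\nvdash f(\overline\varphi)$, $\hat\top\nvdash f(\overline\varphi)$, $g(\overline\psi)\nvdash f(\overline\varphi)$. - $f_L$: $\hat f(\overline\varphi)\nvdash\Sigma$ / $f(\overline\varphi)\nvdash\Sigma$. $g_R$: $\Pi\nvdash\check g(\overline\varphi)$ / $\Pi\nvdash g(\overline\varphi)$. - $f_R$: from $\Upsilon_i\nvdash^{\epsilon_f(i)}\check\bot^{\epsilon_f(i)}$ for all $i$ and $\Upsilon_j\nvdash^{\epsilon_f(j)}\varphi_j$ for some $j$, infer $\hat f(\overline\Upsilon)\nvdash f(\overline\varphi)$. - $g_L$: from $\hat\top^{\epsilon_g(i)}\nvdash^{\epsilon_g(i)}\Upsilon_i$ for all $i$ and $\varphi_j\nvdash^{\epsilon_g(j)}\Upsilon_j$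 for some $j$, infer $g(\overline\varphi)\nvdash\check g(\overline\Upsilon)$. - For $g_1\ne g_2$: from $\hat\top^{\epsilon_{g_2}(i)}\nvdash^{\epsilon_{g_2}(i)}\Upsilon_i$ for all $i$, infer $g_1(\overline\varphi)\nvdash\check g_2(\overline\Upsilon)$. - For $f_1\neq f_2$: from $\Upsilon_i\nvdash^{\epsilon_{f_1}(i)}\check\bot^{\epsilon_{f_1}(i)}$ for all $i$, infer $\hat f_1(\overline\Upsilon)\nvdash f_2(\overline\varphi)$. - The conclusions of these last four rules must contain no residuals. - Lattice rules: - $\hat\top\nvdash\Sigma$ / $\top\nvdash\Sigma$. $\varphi_i\nvdash\Sigma$ / $\varphi_1\vee\varphi_2\nvdash\Sigma$. $\Pi\nvdash\varphi_i$ / $\Pi\nvdash\varphi_1\wedge\varphi_2$ ($i=1,2$). $\Pi\nvdash\check\bot$ / $\Pi\nvdash\bot$. - $\wedge_L$: for $\Sigma'$ with occurrences $(A_i\wedge B_i)_{i\in I}$ in precedent and $(C_j\vee D_j)_{j\in J}$ in succedent position: from $\varphi\nvdash\Sigma'$, $\psi\nvdash\Sigma'$, $\varphi\wedge\psi\nvdash\Sigma'[A_i]^{pre}$, $\varphi\wedge\psi\nvdash\Sigma'[B_i]^{pre}$, $\varphi\wedge\psi\nvdash\Sigma'[C_j]^{suc}$, $\varphi\wedge\psi\nvdash\Sigma'[D_j]^{suc}$ (all $i,j$), infer $\varphi\wedge\psi\nvdash\Sigma'$. - $\vee_R$: dually, from $\Pi'\nvdash\varphi$, $\Pi'\nvdash\psi$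 and $\Pi'[X]\nvdash\varphi\vee\psi$ for $X$ ranging over $A_i,B_i$ (pre) and $C_j,D_j$ (suc), infer $\Pi'\nvdash\varphi\vee\psi$. - In $\wedge_L$ and $\vee_R$, $\Sigma'$ (resp. $\Pi'$) must not be branching and the conclusion must contain no residuals.
   Formalization: In the definition of branching, the root (if a proper ancestor) must also be labelled +f, +f^, -g or -g^, not only the nodes strictly between it and the +∨/-∧ node; read literally, (p∨q)∧r ⊬ (a∧b)∨c would be neither derivable nor refutable. *)

(* Defs.v *)
From Stdlib Require Import Relation_Operators.
From mathcomp Require Import all_boot.

Set Implicit Arguments.
Unset Strict Implicit.
Unset Printing Implicit Defensive.

(* Order-types and signs are booleans: [true] is 1 (resp. +), [false] is the
   dual order-type (resp. -).  Equality test is then the product of {1,-1}. *)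
Definition ot_mul (a b : bool) : bool := a == b.

Record signature := Signature {
  Fconn : Type;
  Gconn : Type;
  arF : Fconn -> nat;
  arG : Gconn -> nat;
  otF : forall f : Fconn, 'I_(arF f) -> bool;
  otG : forall g : Gconn, 'I_(arG g) -> bool
}.

Inductive formula (L : signature) (At : Type) : Type :=
| Atom of At
| FBot
| FTop
| And of formula L At & formula L At
| Or of formula L At & formula L At
| FF (f : Fconn L) of ('I_(arF f) -> formula L At)
| FG (g : Gconn L) of ('I_(arG g) -> formula L At).

Arguments Atom {L At}.
Arguments FBot {L At}.
Arguments FTop {L At}.
Arguments FF {L At}.
Arguments FG {L At}.

(* The union of F* and G*; as these are disjoint, the structural connective
   (hat or check) attached to [h] is determined by [h], see [in_Fstar]. *)
Inductive connective (L : signature) : Type :=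
| CF of Fconn L
| CG of Gconn L
| Sharp (f : Fconn L) of 'I_(arF f)
| Flat (g : Gconn L) of 'I_(arG g).

Arguments Sharp {L}.
Arguments Flat {L}.

Definition arity L (h : connective L) : nat :=
  match h with
  | CF f => arF f
  | CG g => arG g
  | Sharp f _ => arF f
  | Flat g _ => arG g
  end.

Definition in_Fstar L (h : connective L) : bool :=
  match h with
  | CF _ => true
  | CG _ => false
  | Sharp f i => ~~ otF i
  | Flat g i => otG i
  end.

Definition residual L (h : connective L) : bool :=
  match h with
  | CF _ | CG _ => false
  | Sharp _ _ | Flat _ _ => true
  end.

Definition order_type L (h : connective L) : 'I_(arity h) -> bool :=
  match h return 'I_(arity h) -> bool with
  | CF f => fun j => otF j
  | CG g => fun j => otG j
  | Sharp f i => fun j => if j == i then otF i else ot_mul (otF j) (~~ otF i)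
  | Flat g i => fun j => if j == i then otG i else ot_mul (otG j) (~~ otG i)
  end.

(* Raw structures; precedent and succedent ones are carved out by
   [precedent] and [succedent]. *)
Inductive structure (L : signature) (At : Type) : Type :=
| Fm of formula L At
| STop
| SBot
| SCon (h : connective L) of ('I_(arity h) -> structure L At).

Arguments STop {L At}.
Arguments SBot {L At}.
Arguments SCon {L At}.

(* [well_signed true] is the grammar of precedent structures and
   [well_signed false] that of succedent structures. *)
Fixpoint well_signed L At (b : bool) (X : structure L At) : Prop :=
  match X with
  | Fm _ => True
  | STop => b = true
  | SBot => b = false
  | SCon h a =>
      in_Fstar h = b /\ forall i, well_signed (ot_mul b (order_type i)) (a i)
  end.

Notation precedent := (well_signed true).
Notation succedent := (well_signed false).

Fixpoint residual_free L At (X : structure L At) : Prop :=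
  match X with
  | Fm _ | STop | SBot => True
  | SCon h a => residual h = false /\ forall i, residual_free (a i)
  end.

(* A pair of sides, read as a sequent in [DLE] and as an antisequent
   in [DLEr]. *)
Record sequent (L : signature) (At : Type) := Seq {
  lhs : structure L At;
  rhs : structure L At
}.

Notation "X ⋈ Y" := (Seq X Y) (at level 70, no associativity).

Definition wf_sequent L At (s : sequent L At) : Prop :=
  precedent (lhs s) /\ succedent (rhs s).

Definition no_residuals L At (s : sequent L At) : Prop :=
  residual_free (lhs s) /\ residual_free (rhs s).

(* Turnstile with an order-type as exponent. *)
Definition orient L At (e : bool) (X Y : structure L At) : sequent L At :=
  if e then X ⋈ Y else Y ⋈ X.

Definition bot_ot L At (e : bool) : structure L At := if e then SBot else STop.
Definition top_ot L At (e : bool) : structure L At := if e then STop else SBot.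

Arguments bot_ot {L At}.
Arguments top_ot {L At}.

Definition upd (n : nat) (T : Type) (a : 'I_n -> T) (i : 'I_n) (x : T) :
  'I_n -> T := fun j => if j == i then x else a j.

Inductive display_step L At : sequent L At -> sequent L At -> Prop :=
| display_F1 f (a : 'I_(arF f) -> structure L At) i S :
    otF i = true ->
    display_step (SCon (CF f) a ⋈ S) (a i ⋈ SCon (Sharp f i) (upd a i S))
| display_Fd f (a : 'I_(arF f) -> structure L At) i S :
    otF i = false ->
    display_step (SCon (CF f) a ⋈ S) (SCon (Sharp f i) (upd a i S) ⋈ a i)
| display_G1 g (a : 'I_(arG g) -> structure L At) j P :
    otG j = true ->
    display_step (P ⋈ SCon (CG g) a) (SCon (Flat g j) (upd a j P) ⋈ a j)
| display_Gd g (a : 'I_(arG g) -> structure L At) j P :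
    otG j = false ->
    display_step (P ⋈ SCon (CG g) a) (a j ⋈ SCon (Flat g j) (upd a j P)).

Definition display_equiv L At : sequent L At -> sequent L At -> Prop :=
  clos_refl_sym_trans _ (@display_step L At).

(* One-hole contexts, i.e. occurrences of a substructure.  In [CCon h a i c]
   the hole of [c] sits in the i-th argument and [a i] is ignored. *)
Inductive context (L : signature) (At : Type) : Type :=
| Hole
| CCon (h : connective L) of
    ('I_(arity h) -> structure L At) & 'I_(arity h) & context L At.

Fixpoint plug L At (c : context L At) (X : structure L At) : structure L At :=
  match c with
  | Hole => X
  | CCon h a i c' => SCon h (upd a i (plug c' X))
  end.

(* [K] is a sequent with one marked occurrence.  The displayed remainder must
   not depend on the filler [Y]: this forces the side that gets isolated to be
   the marked occurrence and not another copy of the same structure. *)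
Definition precedent_position L At (K : structure L At -> sequent L At) : Prop :=
  exists S, forall Y, display_equiv (K Y) (Y ⋈ S).
Definition succedent_position L At (K : structure L At -> sequent L At) : Prop :=
  exists P, forall Y, display_equiv (K Y) (P ⋈ Y).

(* [branching_formula b A], [branching b X]: in the generation tree with root
   sign [b] there is a path from the root to a +Or or -And node all of whose
   earlier nodes, the root included, are labelled +f, +f^, -g or -g^ with f, g
   in the original signature. *)
Inductive branching_formula L At : bool -> formula L At -> Prop :=
| branching_or A B : branching_formula true (Or A B)
| branching_and A B : branching_formula false (And A B)
| branching_F f (a : 'I_(arF f) -> formula L At) i :
    branching_formula (ot_mul true (otF i)) (a i) ->
    branching_formula true (FF f a)
| branching_G g (a : 'I_(arG g) -> formula L At) i :
    branching_formula (ot_mul false (otG i)) (a i) ->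
    branching_formula false (FG g a).

Inductive branching L At : bool -> structure L At -> Prop :=
| branching_Fm b A : branching_formula b A -> branching b (Fm A)
| branching_hat f (a : 'I_(arF f) -> structure L At) i :
    branching (ot_mul true (otF i)) (a i) ->
    branching true (SCon (CF f) a)
| branching_check g (a : 'I_(arG g) -> structure L At) i :
    branching (ot_mul false (otG i)) (a i) ->
    branching false (SCon (CG g) a).

(* The weakening rules are the only ones that bring in structures absent from
   the premises, hence the only ones with a well-formedness condition; see
   [DLE_wf]. *)
Inductive DLE L At : sequent L At -> Prop :=
| DLE_id p : DLE (Fm (Atom p) ⋈ Fm (Atom p))
| DLE_cut P A S : DLE (P ⋈ Fm A) -> DLE (Fm A ⋈ S) -> DLE (P ⋈ S)
| DLE_display s t : display_step s t -> DLE s -> DLE t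
| DLE_display_inv s t : display_step s t -> DLE t -> DLE s
| DLE_topW P S : precedent P -> DLE (STop ⋈ S) -> DLE (P ⋈ S)
| DLE_botW P S : succedent S -> DLE (P ⋈ SBot) -> DLE (P ⋈ S)
| DLE_topL S : DLE (STop ⋈ S) -> DLE (Fm FTop ⋈ S)
| DLE_topR : DLE (STop ⋈ Fm FTop)
| DLE_botL : DLE (Fm FBot ⋈ SBot)
| DLE_botR P : DLE (P ⋈ SBot) -> DLE (P ⋈ Fm FBot)
| DLE_andL1 A B S : DLE (Fm A ⋈ S) -> DLE (Fm (And A B) ⋈ S)
| DLE_andL2 A B S : DLE (Fm B ⋈ S) -> DLE (Fm (And A B) ⋈ S)
| DLE_andR A B P :
    DLE (P ⋈ Fm A) -> DLE (P ⋈ Fm B) -> DLE (P ⋈ Fm (And A B))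
| DLE_orL A B S :
    DLE (Fm A ⋈ S) -> DLE (Fm B ⋈ S) -> DLE (Fm (Or A B) ⋈ S)
| DLE_orR1 A B P : DLE (P ⋈ Fm A) -> DLE (P ⋈ Fm (Or A B))
| DLE_orR2 A B P : DLE (P ⋈ Fm B) -> DLE (P ⋈ Fm (Or A B))
| DLE_fL f (phi : 'I_(arF f) -> formula L At) S :
    DLE (SCon (CF f) (fun i => Fm (phi i)) ⋈ S) ->
    DLE (Fm (FF f phi) ⋈ S)
| DLE_gR g (phi : 'I_(arG g) -> formula L At) P :
    DLE (P ⋈ SCon (CG g) (fun i => Fm (phi i))) ->
    DLE (P ⋈ Fm (FG g phi))
| DLE_fR f (a : 'I_(arF f) -> structure L At) phi :
    (forall i, DLE (orient (otF i) (a i) (Fm (phi i)))) ->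
    DLE (SCon (CF f) a ⋈ Fm (FF f phi))
| DLE_gL g (a : 'I_(arG g) -> structure L At) phi :
    (forall i, DLE (orient (otG i) (Fm (phi i)) (a i))) ->
    DLE (Fm (FG g phi) ⋈ SCon (CG g) a).

Inductive DLEr L At : sequent L At -> Prop :=
| DLEr_top_bot : DLEr (STop ⋈ SBot)
| DLEr_atom_bot p : DLEr (Fm (Atom p) ⋈ SBot)
| DLEr_top_atom q : DLEr (STop ⋈ Fm (Atom q))
| DLEr_atoms p q : p <> q -> DLEr (Fm (Atom p) ⋈ Fm (Atom q))
| DLEr_display s t : display_step s t -> DLEr s -> DLEr t
| DLEr_display_inv s t : display_step s t -> DLEr t -> DLEr s
| DLEr_hat_bot f (a : 'I_(arF f) -> structure L At) :
    no_residuals (SCon (CF f) a ⋈ SBot) ->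
    (forall i, DLEr (orient (otF i) (a i) (bot_ot (otF i)))) ->
    DLEr (SCon (CF f) a ⋈ SBot)
| DLEr_hat_atom f (a : 'I_(arF f) -> structure L At) p :
    no_residuals (SCon (CF f) a ⋈ Fm (Atom p)) ->
    (forall i, DLEr (orient (otF i) (a i) (bot_ot (otF i)))) ->
    DLEr (SCon (CF f) a ⋈ Fm (Atom p))
| DLEr_top_check g (a : 'I_(arG g) -> structure L At) :
    no_residuals (STop ⋈ SCon (CG g) a) ->
    (forall i, DLEr (orient (otG i) (top_ot (otG i)) (a i))) ->
    DLEr (STop ⋈ SCon (CG g) a)
| DLEr_atom_check g (a : 'I_(arG g) -> structure L At) p :
    no_residuals (Fm (Atom p) ⋈ SCon (CG g) a) ->
    (forall i, DLEr (orient (otG i) (top_ot (otG i)) (a i))) ->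
    DLEr (Fm (Atom p) ⋈ SCon (CG g) a)
| DLEr_hat_check f g (a : 'I_(arF f) -> structure L At)
      (b : 'I_(arG g) -> structure L At) :
    no_residuals (SCon (CF f) a ⋈ SCon (CG g) b) ->
    (forall i, DLEr (orient (otF i) (a i) (bot_ot (otF i)))) ->
    (forall i, DLEr (orient (otG i) (top_ot (otG i)) (b i))) ->
    DLEr (SCon (CF f) a ⋈ SCon (CG g) b)
| DLEr_g_bot g phi : DLEr (Fm (FG g phi) ⋈ SBot)
| DLEr_g_atom g phi p : DLEr (Fm (FG g phi) ⋈ Fm (Atom p))
| DLEr_atom_f f phi p : DLEr (Fm (Atom p) ⋈ Fm (FF f phi))
| DLEr_top_f f phi : DLEr (STop ⋈ Fm (FF f phi))
| DLEr_g_f g f psi phi : DLEr (Fm (FG g psi) ⋈ Fm (FF f phi))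
| DLEr_fL f (phi : 'I_(arF f) -> formula L At) S :
    DLEr (SCon (CF f) (fun i => Fm (phi i)) ⋈ S) ->
    DLEr (Fm (FF f phi) ⋈ S)
| DLEr_gR g (phi : 'I_(arG g) -> formula L At) P :
    DLEr (P ⋈ SCon (CG g) (fun i => Fm (phi i))) ->
    DLEr (P ⋈ Fm (FG g phi))
| DLEr_fR f (a : 'I_(arF f) -> structure L At) phi j :
    no_residuals (SCon (CF f) a ⋈ Fm (FF f phi)) ->
    (forall i, DLEr (orient (otF i) (a i) (bot_ot (otF i)))) ->
    DLEr (orient (otF j) (a j) (Fm (phi j))) ->
    DLEr (SCon (CF f) a ⋈ Fm (FF f phi))
| DLEr_gL g (a : 'I_(arG g) -> structure L At) phi j :
    no_residuals (Fm (FG g phi) ⋈ SCon (CG g) a) ->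
    (forall i, DLEr (orient (otG i) (top_ot (otG i)) (a i))) ->
    DLEr (orient (otG j) (Fm (phi j)) (a j)) ->
    DLEr (Fm (FG g phi) ⋈ SCon (CG g) a)
| DLEr_gL_neq g1 g2 phi (a : 'I_(arG g2) -> structure L At) :
    g1 <> g2 ->
    no_residuals (Fm (FG g1 phi) ⋈ SCon (CG g2) a) ->
    (forall i, DLEr (orient (otG i) (top_ot (otG i)) (a i))) ->
    DLEr (Fm (FG g1 phi) ⋈ SCon (CG g2) a)
| DLEr_fR_neq f1 f2 (a : 'I_(arF f1) -> structure L At) phi :
    f1 <> f2 ->
    no_residuals (SCon (CF f1) a ⋈ Fm (FF f2 phi)) ->
    (forall i, DLEr (orient (otF i) (a i) (bot_ot (otF i)))) ->
    DLEr (SCon (CF f1) a ⋈ Fm (FF f2 phi))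
| DLEr_topL S : DLEr (STop ⋈ S) -> DLEr (Fm FTop ⋈ S)
| DLEr_orL1 A B S : DLEr (Fm A ⋈ S) -> DLEr (Fm (Or A B) ⋈ S)
| DLEr_orL2 A B S : DLEr (Fm B ⋈ S) -> DLEr (Fm (Or A B) ⋈ S)
| DLEr_andR1 A B P : DLEr (P ⋈ Fm A) -> DLEr (P ⋈ Fm (And A B))
| DLEr_andR2 A B P : DLEr (P ⋈ Fm B) -> DLEr (P ⋈ Fm (And A B))
| DLEr_botR P : DLEr (P ⋈ SBot) -> DLEr (P ⋈ Fm FBot)
| DLEr_andL phi psi S :
    ~ branching false S ->
    no_residuals (Fm (And phi psi) ⋈ S) ->
    DLEr (Fm phi ⋈ S) ->
    DLEr (Fm psi ⋈ S) ->
    (forall c A B, S = plug c (Fm (And A B)) ->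
       precedent_position (fun Y => Fm (And phi psi) ⋈ plug c Y) ->
       DLEr (Fm (And phi psi) ⋈ plug c (Fm A))) ->
    (forall c A B, S = plug c (Fm (And A B)) ->
       precedent_position (fun Y => Fm (And phi psi) ⋈ plug c Y) ->
       DLEr (Fm (And phi psi) ⋈ plug c (Fm B))) ->
    (forall c C D, S = plug c (Fm (Or C D)) ->
       succedent_position (fun Y => Fm (And phi psi) ⋈ plug c Y) ->
       DLEr (Fm (And phi psi) ⋈ plug c (Fm C))) ->
    (forall c C D, S = plug c (Fm (Or C D)) ->
       succedent_position (fun Y => Fm (And phi psi) ⋈ plug c Y) ->
       DLEr (Fm (And phi psi) ⋈ plug c (Fm D))) ->
    DLEr (Fm (And phi psi) ⋈ S)
| DLEr_orR phi psi P :
    ~ branching true P ->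
    no_residuals (P ⋈ Fm (Or phi psi)) ->
    DLEr (P ⋈ Fm phi) ->
    DLEr (P ⋈ Fm psi) ->
    (forall c A B, P = plug c (Fm (And A B)) ->
       precedent_position (fun Y => plug c Y ⋈ Fm (Or phi psi)) ->
       DLEr (plug c (Fm A) ⋈ Fm (Or phi psi))) ->
    (forall c A B, P = plug c (Fm (And A B)) ->
       precedent_position (fun Y => plug c Y ⋈ Fm (Or phi psi)) ->
       DLEr (plug c (Fm B) ⋈ Fm (Or phi psi))) ->
    (forall c C D, P = plug c (Fm (Or C D)) ->
       succedent_position (fun Y => plug c Y ⋈ Fm (Or phi psi)) ->
       DLEr (plug c (Fm C) ⋈ Fm (Or phi psi))) ->
    (forall c C D, P = plug c (Fm (Or C D)) ->
       succedent_position (fun Y => plug c Y ⋈ Fm (Or phi psi)) ->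
       DLEr (plug c (Fm D) ⋈ Fm (Or phi psi))) ->
    DLEr (P ⋈ Fm (Or phi psi)).

(* Both calculi only ever produce well-formed sequents, so working on raw
   structures adds no derivations. *)

Lemma display_step_wf L At (s t : sequent L At) :
  display_step s t -> wf_sequent s <-> wf_sequent t.
Proof.
have wfF n (a : 'I_n -> structure L At) (i : 'I_n) (e : 'I_n -> bool) b S c :
    (forall j, j != i -> ot_mul b (e j) = ot_mul c (ot_mul (e j) (~~ e i))) ->
    ((forall j, well_signed (ot_mul b (e j)) (a j)) /\
      well_signed (ot_mul c (e i)) S) <->
    (well_signed (ot_mul b (e i)) (a i) /\
     forall j, well_signed (ot_mul c
       (if j == i then e i else ot_mul (e j) (~~ e i))) (upd a i S j)).
  move=> E; split=> [[Ha HS]|[Hi Ha]]; split=> //.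
  - move=> j; rewrite /upd; case: eqVneq => [//|ji]; rewrite -E //.
  - move=> j; case: (eqVneq j i) => [->//|ji].
    by have := Ha j; rewrite /upd (negbTE ji) E.
  - by have := Ha i; rewrite /upd eqxx.
case=> [f a i S e|f a i S e|g a i P e|g a i P e]; rewrite /wf_sequent /= e.
- have := @wfF _ a i (fun j => otF j) true S false.
  by rewrite e /= => /(_ ltac:(by move=> j _; case: (otF j))); tauto.
- have := @wfF _ a i (fun j => otF j) true S true.
  by rewrite e /= => /(_ ltac:(by move=> j _; case: (otF j))); tauto.
- have := @wfF _ a i (fun j => otG j) false P true.
  by rewrite e /= => /(_ ltac:(by move=> j _; case: (otG j))); tauto.
- have := @wfF _ a i (fun j => otG j) false P false.
  by rewrite e /= => /(_ ltac:(by move=> j _; case: (otG j))); tauto.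
Qed.

Lemma DLE_wf L At (s : sequent L At) : DLE s -> wf_sequent s.
Proof.
elim=> {s}; try by rewrite /wf_sequent /=; tauto.
- by move=> s t /display_step_wf [? ?] _; auto.
- by move=> s t /display_step_wf [? ?] _; auto.
- move=> f a phi _ IH; do 2![split=> //] => i.
  by move: (IH i) => /=; case: (otF i) => -[].
- move=> g a phi _ IH; do 2![split=> //] => i.
  by move: (IH i) => /=; case: (otG i) => -[].
Qed.

Lemma DLEr_wf L At (s : sequent L At) : DLEr s -> wf_sequent s.
Proof.
have hat (f : Fconn L) (a : 'I_(arF f) -> structure L At) :
    (forall i, wf_sequent (orient (otF i) (a i) (bot_ot (otF i)))) ->
    precedent (SCon (CF f) a).
  by move=> IH; split=> // i; move: (IH i) => /=; case: (otF i) => -[].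
have check (g : Gconn L) (a : 'I_(arG g) -> structure L At) :
    (forall i, wf_sequent (orient (otG i) (top_ot (otG i)) (a i))) ->
    succedent (SCon (CG g) a).
  by move=> IH; split=> // i; move: (IH i) => /=; case: (otG i) => -[].
elim=> {s}; try by rewrite /wf_sequent /=; tauto.
- by move=> s t /display_step_wf [? ?] _; auto.
- by move=> s t /display_step_wf [? ?] _; auto.
- by move=> f a _ _ /hat.
- by move=> f a p _ _ /hat.
- by move=> g a _ _ /check.
- by move=> g a p _ _ /check.
- by move=> f g a b _ _ /hat ? _ /check.
- by move=> f a phi j _ _ /hat.
- by move=> g a phi j _ _ /check.
- by move=> g1 g2 phi a _ _ _ /check.
- by move=> f1 f2 a phi _ _ _ /hat.
Qed.

(* Main.v *)
Require Import Defs.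
From Stdlib Require Import Relation_Operators Classical FunctionalExtensionality.
From mathcomp Require Import all_boot zify.

(** By induction on the size of an underivable residual-free sequent, some rule
    of D.LE^r has that sequent as conclusion and smaller underivable premises.
    In a residual-free sequent every leaf can be displayed by unfolding original
    connectives only.  If some leaf carries the principal connective of an
    invertible D.LE rule, display it, refute one of the premises of that rule and
    undo the display.  Otherwise both sides are non-branching, and the shape of
    the two roots determines the refutation rule to apply. *)

Set Implicit Arguments.
Unset Strict Implicit.
Unset Printing Implicit Defensive.

Section Completeness.
Variables (L : signature) (At : Type).
Implicit Types (A B : formula L At) (X Y Z P S : structure L At).
Implicit Types (s t : sequent L At) (K : structure L At -> sequent L At).

(** * Sizes, argument updates and residual-freeness *)

(* Logical symbols weigh twice as much as structural ones, so that passing from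
   [f] to its structural counterpart decreases the size. *)
Fixpoint fsize (A : formula L At) : nat :=
  match A with
  | Atom _ | FBot | FTop => 2
  | And A B | Or A B => (fsize A + fsize B).+2
  | FF f a => (\sum_i fsize (a i)).+2
  | FG g a => (\sum_i fsize (a i)).+2
  end.

Fixpoint ssize (X : structure L At) : nat :=
  match X with
  | Fm A => fsize A
  | STop | SBot => 1
  | SCon h a => (\sum_i ssize (a i)).+1
  end.

Lemma fsize_ge2 A : 2 <= fsize A.
Proof. by case: A. Qed.

Lemma ssize_gt0 X : 0 < ssize X.
Proof. by case: X => //= A; apply: leq_trans (fsize_ge2 A). Qed.

Lemma ssize_arg h (a : 'I_(arity h) -> structure L At) i :
  ssize (a i) < ssize (SCon h a).
Proof. by rewrite /= (bigD1 i) //= ltnS leq_addr. Qed.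

Lemma ltn_ssize_upd h (a : 'I_(arity h) -> structure L At) i X Y :
  ssize X < ssize Y -> ssize (SCon h (upd a i X)) < ssize (SCon h (upd a i Y)).
Proof.
move=> ltXY; rewrite /= !(bigD1 (P := xpredT) i) //= /upd eqxx ltnS -addSn.
apply: leq_add => //; apply: eq_leq.
by apply: eq_bigr => j /negbTE ->.
Qed.

Lemma ltn_ssize_plug (c : context L At) X Y :
  ssize X < ssize Y -> ssize (plug c X) < ssize (plug c Y).
Proof. by move=> ltXY; elim: c => [|h a i c IH] //; apply: ltn_ssize_upd. Qed.

Lemma upd_id n (T : Type) (a : 'I_n -> T) i : upd a i (a i) = a.
Proof.
by apply: functional_extensionality => j; rewrite /upd; case: eqP => [->|].
Qed.

Lemma upd_at n (T : Type) (a : 'I_n -> T) i x : upd a i x i = x.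
Proof. by rewrite /upd eqxx. Qed.

Lemma upd_upd n (T : Type) (a : 'I_n -> T) i x y : upd (upd a i x) i y = upd a i y.
Proof. by apply: functional_extensionality => j; rewrite /upd; case: eqP. Qed.

Lemma residual_free_upd h (a : 'I_(arity h) -> structure L At) i X :
  residual_free (SCon h a) -> residual_free X -> residual_free (SCon h (upd a i X)).
Proof. by move=> /= [rh ra] rX; split=> // j; rewrite /upd; case: ifP. Qed.

Lemma residual_free_plug (c : context L At) X Y :
  residual_free (plug c X) -> residual_free Y -> residual_free (plug c Y).
Proof.
move=> + rY; elim: c => [|h a i c IH] //= [rh ra]; split=> // j.
by move: (ra j); rewrite /upd; case: eqP.
Qed.

(** * Display equivalence and displayable positions *)

Lemma display_equiv_ind (Q : sequent L At -> Prop) :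
  (forall s t, display_step s t -> (Q s <-> Q t)) ->
  forall s t, display_equiv s t -> (Q s <-> Q t).
Proof. by move=> stepQ s t; elim=> {s t}; firstorder. Qed.

Lemma DLE_equiv s t : display_equiv s t -> (DLE s <-> DLE t).
Proof.
apply: display_equiv_ind => {}s {}t st.
by split; [apply: DLE_display | apply: DLE_display_inv].
Qed.

Lemma DLEr_equiv s t : display_equiv s t -> (DLEr s <-> DLEr t).
Proof.
apply: display_equiv_ind => {}s {}t st.
by split; [apply: DLEr_display | apply: DLEr_display_inv].
Qed.

Lemma wf_equiv s t : display_equiv s t -> (wf_sequent s <-> wf_sequent t).
Proof. by apply: display_equiv_ind => {}s {}t; apply: display_step_wf. Qed.

(** Convertible to [precedent_position] for [b = true] and to [succedent_position] for [b = false],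
    so that arguments about both can run uniformly in the sign. *)
Definition in_position (b : bool) K : Prop :=
  exists Z, forall Y, display_equiv (K Y) (orient b Y Z).

(** One further display step isolates the argument. The new remainder overwrites coordinate [i] with
    [Z], hence stays independent of the filler. Display rules unfold original connectives only,
    whence [residual h = false]. *)
Lemma in_position_arg b K h (a : 'I_(arity h) -> structure L At) i :
  residual h = false -> in_Fstar h = b -> in_position b K ->
  in_position (ot_mul b (order_type i)) (fun Y => K (SCon h (upd a i Y))).
Proof.
move=> + + [Z KZ].
case: h a i => [f|g|//|//] a i _ /= hb; rewrite -hb /= in KZ *.
- case E: (otF i).
    exists (SCon (Sharp f i) (upd a i Z)) => Y.
    apply: rst_trans (KZ _) _; apply: rst_step.
    by have := display_F1 (upd a i Y) Z E; rewrite upd_upd upd_at.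
  exists (SCon (Sharp f i) (upd a i Z)) => Y.
  apply: rst_trans (KZ _) _; apply: rst_step.
  by have := display_Fd (upd a i Y) Z E; rewrite upd_upd upd_at.
- case E: (otG i).
    exists (SCon (Flat g i) (upd a i Z)) => Y.
    apply: rst_trans (KZ _) _; apply: rst_step.
    by have := display_G1 (upd a i Y) Z E; rewrite upd_upd upd_at.
  exists (SCon (Flat g i) (upd a i Z)) => Y.
  apply: rst_trans (KZ _) _; apply: rst_step.
  by have := display_Gd (upd a i Y) Z E; rewrite upd_upd upd_at.
Qed.

(** * Normal structures and the invertible rules *)

(** Selects the leaves to which no invertible rule of D.LE applies. The constants fail for both
    signs: on one side they have an invertible rule, on the other they make the sequent
    derivable. *)
Definition normal_formula (b : bool) A : Prop :=
  match A with
  | Atom _ => True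
  | And _ _ | FG _ _ => b = true
  | Or _ _ | FF _ _ => b = false
  | FBot | FTop => False
  end.

Fixpoint normal (b : bool) X : Prop :=
  match X with
  | Fm A => normal_formula b A
  | STop | SBot => True
  | SCon h a => forall i, normal (ot_mul b (order_type i)) (a i)
  end.

(** A branching path enters a formula leaf at +Or, -And, +f or -g, which are exactly the signed
    roots that normality forbids. *)
Lemma normal_not_branching b X : normal b X -> ~ branching b X.
Proof.
move=> nX bX; elim: bX nX => {b X} [b A bA|f a i _ IH /(_ i)//|g a i _ IH /(_ i)//].
by case: bA.
Qed.

(** The induction hypothesis localised at the hole of [K]. It concerns [K X'] before displaying,
    since the displayed sequent may contain residuals. *)
Definition reducible_in K X : Prop :=
  forall X', residual_free X' -> ssize X' < ssize X ->
  wf_sequent (K X') -> ~ DLE (K X') -> DLEr (K X').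

Lemma normal_or_refutable_formula b K A :
  in_position b K -> wf_sequent (K (Fm A)) -> ~ DLE (K (Fm A)) ->
  reducible_in K (Fm A) -> normal b (Fm A) \/ DLEr (K (Fm A)).
Proof.
move=> [Z KZ] /wf_equiv-/(_ _ (KZ _)) wf nder red.
have {}nder : ~ DLE (orient b (Fm A) Z) by rewrite -(DLE_equiv (KZ _)).
have {}red X' : residual_free X' -> ssize X' < fsize A ->
    wf_sequent (orient b X' Z) -> ~ DLE (orient b X' Z) -> DLEr (orient b X' Z).
  (* Undo the display, apply the hypothesis to the residual-free sequent, and display again. *)
  move=> rX' lt wX' dX'; apply/(DLEr_equiv (KZ _)); apply: red => //.
    by apply/(wf_equiv (KZ _)).
  by move/(DLE_equiv (KZ _)).
rewrite (DLEr_equiv (KZ _)) => {K KZ}.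
case: A wf nder red => [p|||A B|A B|f a|g a] /=; case: b => /= wf nder red;
  try by left.
- by case: nder; apply: DLE_botW (DLE_botL _ _); case: wf.
- right; apply: DLEr_botR; apply: red => //; first by case: wf.
  by move=> d; apply: nder; apply: DLE_botR.
- right; apply: DLEr_topL; apply: red => //; first by case: wf.
  by move=> d; apply: nder; apply: DLE_topL.
- by case: nder; apply: DLE_topW (DLE_topR _ _); case: wf.
(* Both premises cannot be derivable; an underivable one selects the refutation rule. *)
- right; case: (classic (DLE (Z ⋈ Fm A))) => dA.
    apply: DLEr_andR2; apply: red => //=; first by lia.
    by move=> dB; apply: nder; apply: DLE_andR.
  by apply: DLEr_andR1; apply: red => //=; lia.
- right; case: (classic (DLE (Fm A ⋈ Z))) => dA.
    apply: DLEr_orL2; apply: red => //=; first by lia.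
    by move=> dB; apply: nder; apply: DLE_orL.
  by apply: DLEr_orL1; apply: red => //=; lia.
- right; apply: DLEr_fL; apply: red => //; first by case: wf.
  by move=> d; apply: nder; apply: DLE_fL.
- right; apply: DLEr_gR; apply: red => //; first by case: wf.
  by move=> d; apply: nder; apply: DLE_gR.
Qed.

Lemma normal_or_refutable X b K :
  in_position b K -> wf_sequent (K X) -> residual_free X -> ~ DLE (K X) ->
  reducible_in K X -> normal b X \/ DLEr (K X).
Proof.
elim: X b K => [A|||h a IH] b K posK wf rX nder red; try by left.
  exact: normal_or_refutable_formula.
(* Excluding refutability beforehand turns the disjunction obtained for each argument into normality
   of all of them. *)
case: (classic (DLEr (K (SCon h a)))) => [|nr]; [by right | left=> /= i].
have [rh ra] := rX.
have hb : in_Fstar h = b.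
  case: posK => Z KZ; move/(wf_equiv (KZ _)): wf.
  by case: b {KZ} => -[] /=; tauto.
have posi := in_position_arg a i rh hb posK.
have := IH i _ _ posi; rewrite upd_id => /(_ wf (ra i) nder) [|//|//].
move=> X' rX' lt wX' dX'; apply: red => //; first exact: residual_free_upd.
by rewrite -{2}(upd_id a i); apply: ltn_ssize_upd.
Qed.

(** * Premises common to the rules for structural connectives *)

(** If one of these sequents were derivable, weakening would replace the constant by the remainder
    of the display of [a i], and undoing the display would derive the whole sequent. *)
Lemma hat_underivable f (a : 'I_(arF f) -> structure L At) S :
  wf_sequent (SCon (CF f) a ⋈ S) -> ~ DLE (SCon (CF f) a ⋈ S) ->
  forall i, ~ DLE (orient (otF i) (a i) (bot_ot (otF i))).
Proof.
move=> wf nder i; case E: (otF i) => d; apply: nder.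
  have st := display_F1 a S E; apply: (DLE_display_inv st).
  by apply: DLE_botW d; case/(display_step_wf st): wf.
have st := display_Fd a S E; apply: (DLE_display_inv st).
by apply: DLE_topW d; case/(display_step_wf st): wf.
Qed.

Lemma check_underivable g (a : 'I_(arG g) -> structure L At) P :
  wf_sequent (P ⋈ SCon (CG g) a) -> ~ DLE (P ⋈ SCon (CG g) a) ->
  forall i, ~ DLE (orient (otG i) (top_ot (otG i)) (a i)).
Proof.
move=> wf nder i; case E: (otG i) => d; apply: nder.
  have st := display_G1 a P E; apply: (DLE_display_inv st).
  by apply: DLE_topW d; case/(display_step_wf st): wf.
have st := display_Gd a P E; apply: (DLE_display_inv st).
by apply: DLE_botW d; case/(display_step_wf st): wf.
Qed.

Definition refutable_below n : Prop :=
  forall s, ssize (lhs s) + ssize (rhs s) < n ->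
  wf_sequent s -> no_residuals s -> ~ DLE s -> DLEr s.

Lemma hat_premises f (a : 'I_(arF f) -> structure L At) S :
  refutable_below (ssize (SCon (CF f) a) + ssize S) ->
  wf_sequent (SCon (CF f) a ⋈ S) -> no_residuals (SCon (CF f) a ⋈ S) ->
  ~ DLE (SCon (CF f) a ⋈ S) ->
  forall i, DLEr (orient (otF i) (a i) (bot_ot (otF i))).
Proof.
move=> IH wf [[_ ra] _] nder i; have := hat_underivable wf nder (i := i).
(* The constant in the premise has size 1, at most that of [S], while [a i] is strictly smaller than
   the hat structure. *)
have lt := @ssize_arg (CF f) a i; have S0 := ssize_gt0 S.
have [[_ /(_ i) wa] _] := wf; move: wa => /=.
rewrite /= in lt.
by case: (otF i) => /= wa d; (apply: IH => //=; [lia | split=> //; apply: ra]).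
Qed.

Lemma check_premises g (a : 'I_(arG g) -> structure L At) P :
  refutable_below (ssize P + ssize (SCon (CG g) a)) ->
  wf_sequent (P ⋈ SCon (CG g) a) -> no_residuals (P ⋈ SCon (CG g) a) ->
  ~ DLE (P ⋈ SCon (CG g) a) ->
  forall i, DLEr (orient (otG i) (top_ot (otG i)) (a i)).
Proof.
move=> IH wf [_ [_ ra]] nder i; have := check_underivable wf nder (i := i).
have lt := @ssize_arg (CG g) a i; have P0 := ssize_gt0 P.
have [_ [_ /(_ i) wa]] := wf; move: wa => /=.
rewrite /= in lt.
by case: (otG i) => /= wa d; (apply: IH => //=; [lia | split=> //; apply: ra]).
Qed.

(** * Matching connectives and the lattice rules *)

Lemma refute_same_f f (a : 'I_(arF f) -> structure L At) phi :
  refutable_below (ssize (SCon (CF f) a) + ssize (Fm (FF f phi))) ->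
  wf_sequent (SCon (CF f) a ⋈ Fm (FF f phi)) ->
  no_residuals (SCon (CF f) a ⋈ Fm (FF f phi)) ->
  ~ DLE (SCon (CF f) a ⋈ Fm (FF f phi)) ->
  DLEr (SCon (CF f) a ⋈ Fm (FF f phi)).
Proof.
move=> IH wf nr nder.
(* Otherwise [DLE_fR] would derive the sequent; this [j] is the distinguished premise of the
   refutation rule. *)
have [j nj] : exists j, ~ DLE (orient (otF j) (a j) (Fm (phi j))).
  by apply: not_all_ex_not => d; apply: nder; apply: DLE_fR.
apply: (@DLEr_fR _ _ _ _ _ j) => //; first exact: hat_premises IH _ _ _.
have lt := @ssize_arg (CF f) a j; have [[_ /(_ j) wa] _] := wf.
have [[_ ra] _] := nr.
have lt' : fsize (phi j) < ssize (Fm (FF f phi)).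
  by rewrite /= (bigD1 j) //= ltnS; lia.
rewrite /= in lt lt'; move: wa nj => /=.
by case: (otF j) => /= wa nj; (apply: IH => //=; [lia | split=> //; apply: ra]).
Qed.

Lemma refute_same_g g (a : 'I_(arG g) -> structure L At) phi :
  refutable_below (ssize (Fm (FG g phi)) + ssize (SCon (CG g) a)) ->
  wf_sequent (Fm (FG g phi) ⋈ SCon (CG g) a) ->
  no_residuals (Fm (FG g phi) ⋈ SCon (CG g) a) ->
  ~ DLE (Fm (FG g phi) ⋈ SCon (CG g) a) ->
  DLEr (Fm (FG g phi) ⋈ SCon (CG g) a).
Proof.
move=> IH wf nr nder.
have [j nj] : exists j, ~ DLE (orient (otG j) (Fm (phi j)) (a j)).
  by apply: not_all_ex_not => d; apply: nder; apply: DLE_gL.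
apply: (@DLEr_gL _ _ _ _ _ j) => //; first exact: check_premises IH _ _ _.
have lt := @ssize_arg (CG g) a j; have [_ [_ /(_ j) wa]] := wf.
have [_ [_ ra]] := nr.
have lt' : fsize (phi j) < ssize (Fm (FG g phi)).
  by rewrite /= (bigD1 j) //= ltnS; lia.
rewrite /= in lt lt'; move: wa nj => /=.
by case: (otG j) => /= wa nj; (apply: IH => //=; [lia | split=> //; apply: ra]).
Qed.

(** Serves the premises of [DLEr_andL] and [DLEr_orR] that replace an inner meet or join by one of
    its components: displaying the occurrence reduces the claim to a lattice rule of D.LE. *)
Lemma weaken_position b K A B :
  in_position b K -> (forall Z, DLE (orient b (Fm B) Z) -> DLE (orient b (Fm A) Z)) ->
  wf_sequent (K (Fm A)) -> ~ DLE (K (Fm A)) ->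
  wf_sequent (K (Fm B)) /\ ~ DLE (K (Fm B)).
Proof.
move=> [Z KZ] BA; rewrite !(DLE_equiv (KZ _)) !(wf_equiv (KZ _)) => wf nder.
by split; [case: b wf {KZ BA nder} | move/BA].
Qed.

Lemma refute_andL A B S :
  refutable_below (ssize (Fm (And A B)) + ssize S) -> normal false S ->
  wf_sequent (Fm (And A B) ⋈ S) -> no_residuals (Fm (And A B) ⋈ S) ->
  ~ DLE (Fm (And A B) ⋈ S) -> DLEr (Fm (And A B) ⋈ S).
Proof.
move=> IH nS wf nr nder; have [_ rS] := nr.
(* Used with [b = true] for inner meets in precedent position and [b = false] for inner joins in
   succedent position. *)
have plugged b c (C D : formula L At) : S = plug c (Fm C) ->
    in_position b (fun Y => Fm (And A B) ⋈ plug c Y) -> fsize D < fsize C ->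
    (forall Z, DLE (orient b (Fm D) Z) -> DLE (orient b (Fm C) Z)) ->
    DLEr (Fm (And A B) ⋈ plug c (Fm D)).
  move=> eS pos lt DC; rewrite eS in wf nder rS.
  have [wf' nder'] := weaken_position pos DC wf nder.
  apply: IH => //; last by split=> //; apply: residual_free_plug rS _.
  by rewrite ltn_add2l eS; apply: ltn_ssize_plug.
apply: DLEr_andL => //; first exact: normal_not_branching.
- by apply: IH => //= [|d]; [lia | apply: nder; apply: DLE_andL1].
- by apply: IH => //= [|d]; [lia | apply: nder; apply: DLE_andL2].
- move=> c C D eS pos; apply: (plugged true _ _ _ eS pos) => [|Z d] /=; first lia.
  exact: DLE_andL1.
- move=> c C D eS pos; apply: (plugged true _ _ _ eS pos) => [|Z d] /=; first lia.
  exact: DLE_andL2.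
- move=> c C D eS pos; apply: (plugged false _ _ _ eS pos) => [|Z d] /=; first lia.
  exact: DLE_orR1.
- move=> c C D eS pos; apply: (plugged false _ _ _ eS pos) => [|Z d] /=; first lia.
  exact: DLE_orR2.
Qed.

Lemma refute_orR A B P :
  refutable_below (ssize P + ssize (Fm (Or A B))) -> normal true P ->
  wf_sequent (P ⋈ Fm (Or A B)) -> no_residuals (P ⋈ Fm (Or A B)) ->
  ~ DLE (P ⋈ Fm (Or A B)) -> DLEr (P ⋈ Fm (Or A B)).
Proof.
move=> IH nP wf nr nder; have [rP _] := nr.
have plugged b c (C D : formula L At) : P = plug c (Fm C) ->
    in_position b (fun Y => plug c Y ⋈ Fm (Or A B)) -> fsize D < fsize C ->
    (forall Z, DLE (orient b (Fm D) Z) -> DLE (orient b (Fm C) Z)) ->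
    DLEr (plug c (Fm D) ⋈ Fm (Or A B)).
  move=> eP pos lt DC; rewrite eP in wf nder rP.
  have [wf' nder'] := weaken_position pos DC wf nder.
  apply: IH => //; last by split=> //; apply: residual_free_plug rP _.
  by rewrite ltn_add2r eP; apply: ltn_ssize_plug.
apply: DLEr_orR => //; first exact: normal_not_branching.
- by apply: IH => //= [|d]; [lia | apply: nder; apply: DLE_orR1].
- by apply: IH => //= [|d]; [lia | apply: nder; apply: DLE_orR2].
- move=> c C D eP pos; apply: (plugged true _ _ _ eP pos) => [|Z d] /=; first lia.
  exact: DLE_andL1.
- move=> c C D eP pos; apply: (plugged true _ _ _ eP pos) => [|Z d] /=; first lia.
  exact: DLE_andL2.
- move=> c C D eP pos; apply: (plugged false _ _ _ eP pos) => [|Z d] /=; first lia.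
  exact: DLE_orR1.
- move=> c C D eP pos; apply: (plugged false _ _ _ eP pos) => [|Z d] /=; first lia.
  exact: DLE_orR2.
Qed.

(** * Case analysis on the roots and the induction *)

Lemma refute_normal P S :
  refutable_below (ssize P + ssize S) -> normal true P -> normal false S ->
  wf_sequent (P ⋈ S) -> no_residuals (P ⋈ S) -> ~ DLE (P ⋈ S) -> DLEr (P ⋈ S).
Proof.
move=> IH nP nS wf nr nder.
(* Normality and well-formedness leave on the left an atom, a meet, a g-formula, the structural top
   or a structural connective. *)
case: P IH nP wf nr nder => [[p|||A B|A B|f phi|g phi]|||h a] IH nP wf nr nder //;
  try by case: wf.
- case: S IH nS wf nr nder => [[q|||C D|C D|f psi|g psi]|||k b] IH nS wf nr nder //;
    try by case: wf.
  + by apply: DLEr_atoms => pq; apply: nder; rewrite pq; apply: DLE_id.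
  + exact: refute_orR.
  + exact: DLEr_atom_f.
  + exact: DLEr_atom_bot.
  + case: k b IH nS wf nr nder => [f|g|f i|g i] b IH nS wf nr nder;
      [by case: wf => _ [] | | by case: nr => _ [] | by case: nr => _ []].
    by apply: DLEr_atom_check => //; apply: check_premises IH _ _ _.
(* This covers every normal right side, joins included. *)
- exact: refute_andL.
- case: S IH nS wf nr nder => [[q|||C D|C D|f psi|k psi]|||k b] IH nS wf nr nder //;
    try by case: wf.
  + exact: DLEr_g_atom.
  + exact: refute_orR.
  + exact: DLEr_g_f.
  + exact: DLEr_g_bot.
  + case: k b IH nS wf nr nder => [f|k|f i|k i] b IH nS wf nr nder;
      [by case: wf => _ [] | | by case: nr => _ [] | by case: nr => _ []].
    (* Connectives form arbitrary types, so their equality is decided classically. *)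
    case: (classic (g = k)) => [gk|gk]; last first.
      by apply: DLEr_gL_neq => //; apply: check_premises IH _ _ _.
    by subst k; apply: refute_same_g.
- case: S IH nS wf nr nder => [[q|||C D|C D|f psi|g psi]|||k b] IH nS wf nr nder //;
    try by case: wf.
  + exact: DLEr_top_atom.
  + exact: refute_orR.
  + exact: DLEr_top_f.
  + exact: DLEr_top_bot.
  + case: k b IH nS wf nr nder => [f|g|f i|g i] b IH nS wf nr nder;
      [by case: wf => _ [] | | by case: nr => _ [] | by case: nr => _ []].
    by apply: DLEr_top_check => //; apply: check_premises IH _ _ _.
- case: h a IH nP wf nr nder => [f|g|f i|g i] a IH nP wf nr nder;
    [ | by case: wf => -[] | by case: nr => -[] | by case: nr => -[]].
  have hats := hat_premises IH wf nr nder.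
  case: S IH nS wf nr nder => [[q|||C D|C D|k psi|g psi]|||k b] IH nS wf nr nder //;
    try by case: wf.
  + exact: DLEr_hat_atom.
  + exact: refute_orR.
  + case: (classic (f = k)) => [fk|fk]; last exact: DLEr_fR_neq.
    by subst k; apply: refute_same_f.
  + exact: DLEr_hat_bot.
  + case: k b IH nS wf nr nder => [k|g|k i|g i] b IH nS wf nr nder;
      [by case: wf => _ [] | | by case: nr => _ [] | by case: nr => _ []].
    by apply: DLEr_hat_check => //; apply: check_premises IH _ _ _.
Qed.

Lemma underivable_refutable n : refutable_below n.
Proof.
elim: n => [|n IHn] [P S] //= lt wf nr nder.
have {lt}IH : refutable_below (ssize P + ssize S).
  by move=> s lt'; apply: IHn; lia.
have [rP rS] := nr.
(* A whole side is displayed already, so normalisation starts from the empty context. *)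
have posP : in_position true (fun Y => Y ⋈ S) by exists S => Y; apply: rst_refl.
have posS : in_position false (fun Y => P ⋈ Y) by exists P => Y; apply: rst_refl.
have [|nP|//] := normal_or_refutable posP wf rP nder.
  by move=> X' rX' lt wX' dX'; apply: IH => //=; lia.
have [|nS|//] := normal_or_refutable posS wf rS nder.
  by move=> X' rX' lt wX' dX'; apply: IH => //=; lia.
exact: refute_normal.
Qed.

End Completeness.

Theorem theorem2 (L : signature) (At : Type) (P S : structure L At)
  (wfP : precedent P) (wfS : succedent S)
  (nores : no_residuals (P ⋈ S)) (nder : ~ DLE (P ⋈ S)) :
  DLEr (P ⋈ S).
Proof. exact: (underivable_refutable (ltnSn _)). Qed.
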